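(* Let $n\ge 1$ and let $f(x)=x^TAx+2a^Tx+a_0$ and $g(x)=x^TBx+2b^Tx+b_0$ be non-constant functions on $\mathbb{R}^n$, where $A,B$ are real symmetric $n\times n$ matrices, $a,b\in\mathbb{R}^n$ and $a_0,b_0\in\mathbb{R}$. Then the level set $\{g=0\}$ separates the level set $\{f=0\}$ if and only if there exists $\lambda\in\mathbb{R}$ such that $B=\lambda A$ and the level set $\{-\lambda f+g=0\}$ separates $\{f=0\}$.
   Context: For a function $p:\mathbb{R}^n\to\mathbb{R}$ write $\{p=0\}=\{x\in\mathbb{R}^n: p(x)=0\}$. For functions $p,q:\mathbb{R}^n\to\mathbb{R}$, the level set $\{q=0\}$ is said to separate $\{p=0\}$ if there are non-empty subsets $L^-,L^+$ of $\{p=0\}$ such that $\{p=0\}=L^-\cup L^+$ and $q(u)q(v)<0$ for all $u\in L^-$ and all $v\in L^+$. *)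

(* Defs.v *)
From mathcomp Require Import all_boot all_order all_algebra.
From mathcomp Require Import classical_sets reals.

Set Implicit Arguments.
Unset Strict Implicit.
Unset Printing Implicit Defensive.

Import Order.TTheory GRing.Theory Num.Theory.

Local Open Scope classical_set_scope.
Local Open Scope ring_scope.

Definition quadratic_fun (R : realType) (n : nat) (A : 'M[R]_n) (a : 'cV[R]_n)
    (a0 : R) (x : 'cV[R]_n) : R :=
  (x^T *m A *m x) 0 0 + 2 * (a^T *m x) 0 0 + a0.

Definition nonconstant (R : realType) (n : nat) (p : 'cV[R]_n -> R) : Prop :=
  exists x y : 'cV[R]_n, p x <> p y.

Definition zero_level (R : realType) (n : nat) (p : 'cV[R]_n -> R) :
    set 'cV[R]_n :=
  [set x | p x = 0].

(* Although it is phrased with the level set of [q], separation depends on the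
   function [q] itself and not only on the set [zero_level q]. *)
Definition separates (R : realType) (n : nat) (q p : 'cV[R]_n -> R) : Prop :=
  exists Lm Lp : set 'cV[R]_n,
    [/\ Lm !=set0, Lp !=set0, zero_level p = Lm `|` Lp &
        forall u v, Lm u -> Lp v -> q u * q v < 0].

(* Main.v *)
(** Fix [u] and [v] on [{f = 0}] with [g u * g v < 0] and put [w := v - u]. The
    leading coefficient [w^T A w] of [f] on the line through [u] and [v] is
    nonzero, as otherwise [f] vanishes on that line, hence so does [g] somewhere
    on it. Subtracting a multiple [lambda f] from [g], we may assume that [g] is
    affine on the line; it remains to show [d^T B d = 0] for every direction [d],
    which is a question in the plane [u + s w + t d]. There, up to scaling,
    [f = 0] reads [s = 1/2 - beta t +- sqrt (D t)] with [D] quadratic, and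
    [g = h t +- sqrt (D t) * k t] at these two points, with [h] quadratic and [k]
    affine. The product [P = h^2 - D k^2] of the two values is negative at [0] and
    cannot vanish where [D >= 0]. As [P >= 0] at the zeros of [D], there is no such
    zero, so [D > 0] and [P < 0] everywhere. Therefore [k] has no zero and is
    constant, and [h^2 < D k^2] with a right-hand side of degree at most two kills
    the leading coefficient of [h]. *)

Require Import Defs.
From mathcomp Require Import all_boot all_order all_algebra.
From mathcomp Require Import classical_sets reals.
From mathcomp Require Import ring lra.

Set Implicit Arguments.
Unset Strict Implicit.
Unset Printing Implicit Defensive.

Import Order.TTheory GRing.Theory Num.Theory.

Local Open Scope ring_scope.

(** * Zeros and signs of real polynomials, and plane conics *)

Lemma poly_root_segment (R : rcfType) (p : {poly R}) (t : R) :
  p.[0] < 0 -> 0 <= p.[t] -> exists2 x, 0 < x <= 1 & p.[x * t] = 0.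
Proof.
move=> p0 pt.
have [||x /andP[x0 x1]] := @poly_ivt _ (p \Po (t *: 'X)) 0 1.
- exact: ler01.
- by rewrite !horner_comp !hornerE ltW // mulrC.
rewrite /root horner_comp !hornerE mulrC => /eqP px.
exists x => //; rewrite x1 andbT lt_neqAle x0 andbT.
by apply: contraTneq p0 => xE; rewrite -xE mul0r in px; rewrite px ltxx.
Qed.

(** Splitting off the root [x] leaves [(x - y) * (l - e2 * y)] with [l = c / x > 0]. The first root
    is [x], unless [l / e2] lies between [0] and [x]. *)
Lemma quadratic_first_root (R : rcfType) (c e1 e2 x : R) :
  0 < c -> 0 < x -> c + e1 * x + e2 * x ^+ 2 = 0 ->
  exists x0, [/\ 0 < x0, c + e1 * x0 + e2 * x0 ^+ 2 = 0 &
    forall y, 0 <= y <= x0 -> 0 <= c + e1 * y + e2 * y ^+ 2].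
Proof.
move=> c0 x0 Dx; pose l := - e1 - x * e2.
have lx : l * x = c by rewrite /l; lra.
have l0 : 0 < l by rewrite -(pmulr_lgt0 _ x0) lx.
have DE y : c + e1 * y + e2 * y ^+ 2 = (x - y) * (l - e2 * y).
  by rewrite -lx /l; ring.
have [h|h] := lerP 0 (l - e2 * x).
- exists x; split=> // y /andP[y0 yx]; rewrite DE mulr_ge0 ?subr_ge0 //.
  rewrite -subr_ge0 -(pmulr_rge0 _ x0).
  have -> : x * (l - e2 * y) = (x - y) * l + y * (l - e2 * x) by ring.
  by rewrite addr_ge0 // mulr_ge0 ?(ltW l0) ?subr_ge0 // -subr_ge0.
- have e20 : 0 < e2 by rewrite -(pmulr_lgt0 _ x0); lra.
  exists (l / e2); split; first exact: divr_gt0.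
    by rewrite DE [e2 * _]mulrC divfK ?gt_eqF // subrr mulr0.
  move=> y /andP[y0]; rewrite ler_pdivlMr // => ye.
  rewrite DE mulr_ge0 // subr_ge0; last by rewrite mulrC.
  by rewrite -(ler_pM2r e20); lra.
Qed.

Lemma quadratic_neg_lead (R : realFieldType) (p q r : R) :
  (forall T, 0 <= T -> p * T ^+ 2 + q * T + r < 0) -> p <= 0.
Proof.
move=> H; rewrite leNgt; apply/negP => p0.
(* With this [T], the factor [p * T] absorbs [q] and [r], so that the value at [T] becomes a sum of
   nonnegative terms. *)
pose T := (`|q| + `|r|) / p + 1.
have T1 : 1 <= T by rewrite lerDr divr_ge0 ?addr_ge0 ?(ltW p0).
have pT : p * T = `|q| + `|r| + p.
  by rewrite /T mulrDr mulr1 mulrC divfK ?gt_eqF.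
have := H T (le_trans ler01 T1).
have -> : p * T ^+ 2 + q * T + r =
    (`|q| + q) * T + `|r| * (T - 1) + (`|r| + r) + p * T.
  have -> : p * T ^+ 2 = p * T * T by ring.
  rewrite {1}pT; ring.
apply/negP; rewrite -leNgt.
have q0 : 0 <= `|q| + q by have := ler_norm (- q); rewrite normrN; lra.
have r0 : 0 <= `|r| + r by have := ler_norm (- r); rewrite normrN; lra.
have T0 := le_trans ler01 T1.
have pT0 : 0 <= p * T by rewrite mulr_ge0 // ltW.
have qT0 := mulr_ge0 q0 T0.
have rT0 : 0 <= `|r| * (T - 1) by rewrite mulr_ge0 ?subr_ge0.
lra.
Qed.

Lemma quadratic_sqr_lt_quadratic (R : rcfType) (p m n a b c : R) :
  (forall t, (p * t ^+ 2 + m * t + n) ^+ 2 < a * t ^+ 2 + b * t + c) -> p = 0.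
Proof.
move=> H.
suff : p ^+ 2 <= 0.
  by move=> p2; apply/eqP; rewrite -sqrf_eq0 eq_le p2 sqr_ge0.
(* Adding the inequalities at [t] and [- t] leaves only even powers of [t]. *)
apply: (@quadratic_neg_lead _ _ (2 * p * n + m ^+ 2 - a) (n ^+ 2 - c)) => T T0.
have := H (Num.sqrt T); have := H (- Num.sqrt T).
rewrite sqrrN; have := sqr_sqrtr T0; set t := Num.sqrt T => tT H1 H2.
rewrite -tT in H1 H2 *; nra.
Qed.

(** The planar case, normalized: [u] and [v] have coordinates [(0, 0)] and [(1, 0)], [f] is monic in
    [s], and [g] has lost its [s ^+ 2] term. *)
Lemma conic_separation (R : rcfType) (b c d g0 g1 b' c' d' : R) :
  (forall s t, s ^+ 2 - s + t * (2 * b * s + c * t + d) = 0 ->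
    g0 + g1 * s + t * (2 * b' * s + c' * t + d') <> 0) ->
  g0 * (g0 + g1) < 0 -> c' = 0.
Proof.
move=> H g01.
pose m : {poly R} := (1 / 2)%:P - b *: 'X.
pose D : {poly R} := m ^+ 2 - c *: 'X ^+ 2 - d *: 'X.
pose k : {poly R} := g1%:P + (2 * b') *: 'X.
pose h : {poly R} :=
  g0%:P + g1 *: m + (2 * b') *: ('X * m) + c' *: 'X ^+ 2 + d' *: 'X.
pose P : {poly R} := h ^+ 2 - D * k ^+ 2.
pose evalE := (hornerD, hornerN, hornerZ, hornerM, @horner_exp R, hornerX,
  @hornerC R).
have mE t : m.[t] = 1 / 2 - b * t by rewrite !evalE.
have DE t : D.[t] = (1 / 2 - b * t) ^+ 2 - c * t ^+ 2 - d * t.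
  by rewrite !evalE.
have kE t : k.[t] = g1 + 2 * b' * t by rewrite !evalE.
have hE t : h.[t] = g0 + g1 * (1 / 2 - b * t)
    + 2 * b' * (t * (1 / 2 - b * t)) + c' * t ^+ 2 + d' * t.
  by rewrite !evalE.
have PE t : P.[t] = h.[t] ^+ 2 - D.[t] * k.[t] ^+ 2.
  by rewrite /P !(hornerD, hornerN, hornerM, horner_exp).
(* At [t = 0] the two points are [s = 0] and [s = 1], so [P.[0] = g0 * (g0 + g1)]. *)
have P0 : P.[0] < 0 by rewrite PE hE DE kE; lra.
have nzP t : 0 <= D.[t] -> P.[t] != 0.
  move=> Dt; pose r := Num.sqrt D.[t].
  have rD : r ^+ 2 = D.[t] by rewrite sqr_sqrtr.
  have -> : P.[t] = (h.[t] + r * k.[t]) * (h.[t] - r * k.[t]).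
    by rewrite PE -rD; ring.
  rewrite DE in rD.
  have factor_neq0 e : e ^+ 2 = r ^+ 2 -> h.[t] + e * k.[t] != 0.
    rewrite rD => eD; apply/eqP => he0; apply: (H (m.[t] + e) t).
      by rewrite mE; lra.
    by rewrite -he0 hE kE mE; ring.
  by rewrite mulf_neq0 ?factor_neq0 // -mulNr factor_neq0 // sqrrN.
have Dgt0 t : 0 < D.[t].
  rewrite ltNge; apply/negP => Dt.
  (* Going from [0] towards [t], stop at the first zero of [D]: up to there [D >= 0], yet [P] must
     vanish on the way. *)
  have [||x /andP[x0 _] Dx] := @poly_root_segment _ (- D) t.
  - by rewrite hornerN DE; lra.
  - by rewrite hornerN oppr_ge0.
  pose e1 := (- b - d) * t; pose e2 := (b ^+ 2 - c) * t ^+ 2.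
  have DtE y : D.[y * t] = 1 / 4 + e1 * y + e2 * y ^+ 2.
    by rewrite DE /e1 /e2; field.
  have [||z [z0 Dz Dge0]] := @quadratic_first_root _ (1 / 4) e1 e2 x _ x0.
  - by lra.
  - by apply/eqP; rewrite -DtE -oppr_eq0 -hornerN Dx.
  have [//||y /andP[y0 y1] Py] := @poly_root_segment _ P (z * t).
    by rewrite PE DtE Dz mul0r subr0 sqr_ge0.
  suff Dy : 0 <= D.[y * (z * t)] by move: (nzP _ Dy); rewrite Py eqxx.
  by rewrite mulrA DtE Dge0 // ler_piMl ?mulr_ge0 // ltW.
have Plt0 t : P.[t] < 0.
  rewrite ltNge; apply/negP => Pt.
  have [x _ Px] := poly_root_segment P0 Pt.
  by move: (nzP (x * t) (ltW (Dgt0 _))); rewrite Px eqxx.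
have b'0 : b' = 0.
  apply/eqP; apply/negPn/negP => b'0.
  have := Plt0 (- g1 / (2 * b')); rewrite PE kE.
  rewrite [2 * b' * _]mulrC divfK ?mulf_neq0 ?pnatr_eq0 // subrr.
  by rewrite expr0n mulr0 subr0 ltNge sqr_ge0.
(* For [b' = 0] these are the coefficients of [h] and of [g1 ^+ 2 * D]. *)
apply: (@quadratic_sqr_lt_quadratic R _ (d' - g1 * b) (g0 + g1 / 2)
  ((b ^+ 2 - c) * g1 ^+ 2) (- (b + d) * g1 ^+ 2) (g1 ^+ 2 / 4)) => t.
by have := Plt0 t; rewrite PE hE DE kE b'0; lra.
Qed.

(** * Bilinear forms and restriction to a plane *)

Definition bilin (R : realType) n (A : 'M[R]_n) (x y : 'cV[R]_n) : R :=
  (x^T *m A *m y) 0 0.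

Lemma bilinDl (R : realType) n (A : 'M[R]_n) x y z :
  bilin A (x + y) z = bilin A x z + bilin A y z.
Proof. by rewrite /bilin [(x + y)^T]linearD /= !mulmxDl mxE. Qed.

Lemma bilinDr (R : realType) n (A : 'M[R]_n) x y z :
  bilin A z (x + y) = bilin A z x + bilin A z y.
Proof. by rewrite /bilin mulmxDr mxE. Qed.

Lemma bilinZl (R : realType) n (A : 'M[R]_n) r x y :
  bilin A (r *: x) y = r * bilin A x y.
Proof. by rewrite /bilin [(r *: x)^T]linearZ /= -!scalemxAl mxE. Qed.

Lemma bilinZr (R : realType) n (A : 'M[R]_n) r x y :
  bilin A y (r *: x) = r * bilin A y x.
Proof. by rewrite /bilin -scalemxAr mxE. Qed.

Lemma bilin_sym (R : realType) n (A : 'M[R]_n) x y :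
  A^T = A -> bilin A x y = bilin A y x.
Proof.
move=> AE; rewrite /bilin; transitivity ((x^T *m A *m y)^T 0 0).
  by rewrite [RHS]mxE.
by rewrite !trmx_mul trmxK AE mulmxA.
Qed.

(** Polarization on pairs of basis vectors. *)
Lemma bilin_eq0 (R : realType) n (A : 'M[R]_n) :
  A^T = A -> (forall x, bilin A x x = 0) -> A = 0.
Proof.
move=> AE A0; apply/matrixP => i j; rewrite !mxE.
have -> : A i j = bilin A (delta_mx i 0) (delta_mx j 0).
  by rewrite /bilin trmx_delta -rowE -colE !mxE.
set x := delta_mx i 0; set y := delta_mx j 0.
have := A0 (x + y); have := A0 x; have := A0 y.
rewrite !(bilinDl, bilinDr) (bilin_sym y) //; lra.
Qed.

Lemma bilin_subZ (R : realType) n (A B : 'M[R]_n) l x y :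
  bilin (B - l *: A) x y = bilin B x y - l * bilin A x y.
Proof.
rewrite /bilin mulmxBr mulmxBl -scalemxAr -scalemxAl.
by rewrite !mxE.
Qed.

Lemma quadratic_fun_plane (R : realType) n (A : 'M[R]_n) a a0 u w d s t :
  A^T = A ->
  quadratic_fun A a a0 (u + s *: w + t *: d) =
    quadratic_fun A a a0 u +
    s ^+ 2 * bilin A w w + 2 * s * t * bilin A w d + t ^+ 2 * bilin A d d +
    2 * s * (bilin A u w + (a^T *m w) 0 0) +
    2 * t * (bilin A u d + (a^T *m d) 0 0).
Proof.
move=> AE; rewrite /quadratic_fun -!/(bilin A _ _).
have aE : (a^T *m (u + s *: w + t *: d)) 0 0 =
    (a^T *m u) 0 0 + s * (a^T *m w) 0 0 + t * (a^T *m d) 0 0.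
  by rewrite !mulmxDr -!scalemxAr !mxE.
rewrite aE !(bilinDl, bilinDr, bilinZl, bilinZr) (bilin_sym w u) // (bilin_sym d u) //.
by rewrite (bilin_sym d w) //; ring.
Qed.

(** * Separation of level sets *)

Lemma separates_sign_change (R : realType) n (p q : 'cV[R]_n -> R) :
  separates q p ->
  exists u v, [/\ p u = 0, p v = 0, q u * q v < 0 &
    forall x, p x = 0 -> q x <> 0].
Proof.
move=> [Lm [Lp [[u Lu] [v Lv] pE quv]]].
have zeroP x : zero_level p x <-> Lm x \/ Lp x by rewrite pE.
exists u, v; split; [apply/zeroP; by left|apply/zeroP; by right|exact: quv|].
move=> x /zeroP[Lx|Lx] qx.
  by have := quv _ _ Lx Lv; rewrite qx mul0r ltxx.
by have := quv _ _ Lu Lx; rewrite qx mulr0 ltxx.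
Qed.

(** Separation only evaluates [q] on [{p = 0}]; hence adding a multiple of [p] to [q] is
    harmless. *)
Lemma eq_separates (R : realType) n (p q q' : 'cV[R]_n -> R) :
  (forall x, p x = 0 -> q x = q' x) -> separates q p -> separates q' p.
Proof.
move=> qq' [Lm [Lp [Lm0 Lp0 pE quv]]].
have Lz x : Lm x \/ Lp x -> p x = 0.
  by move=> Lx; have : zero_level p x by rewrite pE.
exists Lm, Lp; split=> // u v Lu Lv.
by rewrite -!qq' ?quv //; apply: Lz; [right|left].
Qed.

Lemma separates_proportional (R : realType) n (A B : 'M[R]_n) a b a0 b0 :
  A^T = A -> B^T = B ->
  separates (quadratic_fun B b b0) (quadratic_fun A a a0) ->
  exists l, B = l *: A.
Proof.
move=> AE BE /separates_sign_change.
set f := quadratic_fun A a a0; set g := quadratic_fun B b b0.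
move=> [u [v [fu fv guv nz]]].
pose w := v - u.
pose La x := bilin A u x + (a^T *m x) 0 0.
pose Lb x := bilin B u x + (b^T *m x) 0 0.
have fE s t d : f (u + s *: w + t *: d) = s ^+ 2 * bilin A w w
    + 2 * s * t * bilin A w d + t ^+ 2 * bilin A d d
    + 2 * s * La w + 2 * t * La d.
  by rewrite /f quadratic_fun_plane // -/f fu add0r.
have gE s t d : g (u + s *: w + t *: d) = g u + s ^+ 2 * bilin B w w
    + 2 * s * t * bilin B w d + t ^+ 2 * bilin B d d
    + 2 * s * Lb w + 2 * t * Lb d.
  by rewrite /g quadratic_fun_plane.
have vE : v = u + 1 *: w + 0 *: w by rewrite scale1r scale0r addr0 addrC subrK.
(* On the line through [u] and [v], [f] is thus [(s ^+ 2 - s) * bilin A w w]. *)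
have Law : 2 * La w = - bilin A w w by move: fv; rewrite vE fE; lra.
have gv : g v = g u + bilin B w w + 2 * Lb w by rewrite vE gE; ring.
have Aw : bilin A w w != 0.
  apply/negP => /eqP Aw.
  (* The factor [g u] makes [p] positive at [0] and negative at [1], whatever the sign of [g u]. *)
  pose p : {poly R} :=
    g u *: ((g u)%:P + (bilin B w w) *: 'X ^+ 2 + (2 * Lb w) *: 'X).
  have pE s : p.[s] = g u * g (u + s *: w + 0 *: w).
    rewrite !(hornerD, hornerZ, horner_exp, hornerX, hornerC) gE; ring.
  have gu0 := nz _ fu.
  have [||s _] := @poly_root_segment _ (- p) 1.
  - rewrite hornerN pE !scale0r !addr0 oppr_lt0 -expr2 exprn_even_gt0 //=.
    exact/eqP.
  - by rewrite hornerN pE -vE oppr_ge0 ltW.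
  rewrite mulr1 hornerN pE => /eqP; rewrite oppr_eq0 mulf_eq0.
  move=> /orP[/eqP//|/eqP]; apply: nz; rewrite fE Aw.
  have -> : 2 * s * La w = s * (2 * La w) by ring.
  by rewrite Law Aw; ring.
(* This choice cancels the [s ^+ 2] term of [g - l * f]. *)
pose l := bilin B w w / bilin A w w; exists l.
apply/eqP; rewrite -subr_eq0; apply/eqP; apply: bilin_eq0.
  by rewrite linearB linearZ /= AE BE.
move=> d; set al := bilin A w w in Aw.
rewrite bilin_subZ.
have lal : l * al = bilin B w w by rewrite /l divfK.
(* The arguments are the coefficients of [f / al] and [g - l * f] in the plane; [Law] turns
   [- l * (2 * La w)] into [bilin B w w]. *)
apply: (@conic_separation _ (bilin A w d / al) (bilin A d d / al)
  (2 * La d / al) (g u) (2 * Lb w + bilin B w w) (bilin B w d - l * bilin A w d) _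
  (2 * Lb d - l * (2 * La d))); last first.
  by have -> : g u + (2 * Lb w + bilin B w w) = g v by rewrite gv; ring.
move=> s t /(congr1 ( *%R al)) fst gst.
have f0 : f (u + s *: w + t *: d) = 0.
  rewrite -[RHS](mulr0 al) -fst fE.
  have -> : 2 * s * La w = s * (2 * La w) by ring.
  by rewrite Law -/al; field.
apply: (nz _ f0).
have -> : g (u + s *: w + t *: d) =
  g (u + s *: w + t *: d) - l * f (u + s *: w + t *: d) by rewrite f0 mulr0 subr0.
rewrite -[RHS]gst gE fE -lal.
have -> : 2 * s * La w = s * (2 * La w) by ring.
by rewrite Law -/al; ring.
Qed.

Theorem theorem2p3 (R : realType) (n : nat) (hn : (1 <= n)%N)
    (A B : 'M[R]_n) (a b : 'cV[R]_n) (a0 b0 : R)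
    (hA : A^T = A) (hB : B^T = B)
    (hf : nonconstant (quadratic_fun A a a0))
    (hg : nonconstant (quadratic_fun B b b0)) :
  let f := quadratic_fun A a a0 in
  let g := quadratic_fun B b b0 in
  separates g f <->
  exists lambda : R,
    B = lambda *: A /\ separates (fun x => - lambda * f x + g x) f.
Proof.
move=> f g; split=> [gf|[l [_]]]; last first.
  by apply: eq_separates => x ->; rewrite mulr0 add0r.
have [l BlA] := separates_proportional hA hB gf.
exists l; split=> //; apply: eq_separates gf => x ->.
by rewrite mulr0 add0r.
Qed.
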